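(* Let $\Omega\subset\mathbb{C}$ be an open set containing an interval of the real axis, let $F:\Omega\to\mathbb{C}$ be holomorphic, and assume that $F(x)\in\mathbb{R}$ for every $x\in\Omega\cap\mathbb{R}$. Then, for every $x\in\Omega\cap\mathbb{R}$, $$\partial_x F(x)=\lim_{h\to 0}\frac{\operatorname{Im}\left[F(x+\mathrm{i}h)\right]}{h}.$$
   Context: Here $\mathrm{i}$ is the imaginary unit, $h$ is a nonzero real number tending to $0$, and $\partial_xF(x)$ denotes the derivative of $F$ with respect to the real variable $x$ at the real point $x$. *)

(* Defs.v *)
From Stdlib Require Import Reals.
From Coquelicot Require Import Coquelicot.

(* Complex differentiability at every point of [Omega]. A function on an open
   [Omega] is represented by a total function whose values outside [Omega] are
   unconstrained: [ex_derive] at a point of [Omega] only sees nearby values. *)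
Definition holomorphic_on (Omega : C -> Prop) (F : C -> C) : Prop :=
  forall z : C, Omega z -> @ex_derive C_AbsRing C_NormedModule F z.

(* Derivative of [F] with respect to the real variable at the real point [x],
   as a function from R to the real normed space C. *)
Definition is_real_derive (F : C -> C) (x : R) (d : C) : Prop :=
  @is_derive R_AbsRing C_R_NormedModule (fun t : R => F (RtoC t)) x d.

(* Main.v *)
(** Write [D] for the complex derivative of [F] at the real point [x]. Since [F]
    is real on the real axis, its difference quotients along real increments are
    real, so [Im D = 0]. Along the imaginary increment [i h] one then has
    [F (x + i h) = F x + i h D + o(h)] with [F x] and [D] real, and taking
    imaginary parts gives [Im (F (x + i h)) = h D + o(h)]. *)

Require Import Defs.
From Stdlib Require Import Reals Lra.
From Coquelicot Require Import Coquelicot.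
Open Scope R_scope.

Lemma Im_le_Cmod (c : C) : Rabs (Im c) <= Cmod c.
Proof.
  apply Rle_trans with (2 := Rmax_Cmod c).
  apply Rmax_r.
Qed.

(** Unfolds the filter-based derivative into an epsilon-delta bound in [Cmod], stated in the
    increment [w] so that real and imaginary increments can both be substituted. *)
Lemma is_C_derive_expansion (F : C -> C) (z D : C) :
  @is_derive C_AbsRing C_NormedModule F z D ->
  forall eps : posreal, exists delta : posreal, forall w : C,
    Cmod w < delta -> Cmod (F (z + w) - F z - w * D)%C <= eps * Cmod w.
Proof.
  intros [_ H] eps.
  destruct (H z (fun P HP => HP) eps) as [delta Hdelta].
  exists delta. intros w Hw.
  assert (E : (z + w - z)%C = w) by ring.
  specialize (Hdelta (z + w)%C).
  change (Cmod (z + w - z)%C < delta ->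
    Cmod (F (z + w) - F z - (z + w - z) * D)%C <= eps * Cmod (z + w - z)%C)
    in Hdelta.
  rewrite E in Hdelta. exact (Hdelta Hw).
Qed.

(** Restricting the complex expansion to real increments suffices, once the norms of [C] over itself
    and over the reals are identified. *)
Lemma is_C_derive_is_real_derive (F : C -> C) (x : R) (D : C) :
  @is_derive C_AbsRing C_NormedModule F (RtoC x) D -> is_real_derive F x D.
Proof.
  intros H. split.
  { apply (@is_linear_scal_l R_AbsRing C_R_NormedModule). }
  intros y Hy eps.
  apply (@is_filter_lim_locally_unique R_AbsRing R_NormedModule) in Hy. subst y.
  destruct (is_C_derive_expansion F x D H eps) as [delta Hdelta].
  exists delta. intros t Ht.
  change (Rabs (t - x) < delta) in Ht.
  specialize (Hdelta (RtoC (t - x))). rewrite Cmod_R in Hdelta.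
  specialize (Hdelta Ht).
  replace (RtoC x + RtoC (t - x))%C with (RtoC t) in Hdelta
    by (rewrite RtoC_minus; ring).
  rewrite <- scal_R_Cmult in Hdelta.
  (* The goal's norm is the product norm, the square root of [|a|^2 + |b|^2]; it equals [Cmod] once
     the absolute values under the squares are dropped. *)
  match goal with |- ?n <= _ =>
    replace n with (Cmod (F t - F x - scal (t - x)%R D)%C) end.
  - exact Hdelta.
  - unfold Cmod, norm; simpl; unfold prod_norm, norm; simpl; unfold abs; simpl.
    rewrite !Rmult_1_r, <- !Rabs_mult, !Rabs_pos_eq by apply Rle_0_sqr.
    reflexivity.
Qed.

(** Balls of [C_UniformSpace] are boxes, and a real shift leaves the imaginary coordinate at the
    centre. *)
Lemma open_C_real_interval (Omega : C -> Prop) (x : R) :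
  @open C_UniformSpace Omega -> Omega (RtoC x) ->
  exists r : posreal, forall t : R, Rabs t < r -> Omega (RtoC (x + t)).
Proof.
  intros Ho Hx. destruct (Ho _ Hx) as [r Hr].
  exists r. intros t Ht. apply Hr. split; simpl.
  - change (Rabs (x + t - x) < r).
    replace (x + t - x) with t by ring. exact Ht.
  - apply ball_center.
Qed.

Lemma Im_derive_real_on_reals (Omega : C -> Prop) (F : C -> C) (x : R) (D : C) :
  @open C_UniformSpace Omega ->
  (forall t : R, Omega (RtoC t) -> Im (F (RtoC t)) = 0) ->
  Omega (RtoC x) ->
  @is_derive C_AbsRing C_NormedModule F (RtoC x) D -> Im D = 0.
Proof.
  intros Ho Hreal Hx HD.
  destruct (open_C_real_interval Omega x Ho Hx) as [r Hr].
  destruct (Req_dec (Im D) 0) as [H0 | H0]; [exact H0 | exfalso].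
  (* With this tolerance the remainder at a real step [t > 0] is at most [t * |Im D| / 2], yet its
     imaginary part has size exactly [t * |Im D|]. *)
  assert (Hpos : 0 < Rabs (Im D) / 2).
  { apply Rabs_pos_lt in H0. lra. }
  destruct (is_C_derive_expansion F x D HD (mkposreal _ Hpos)) as [delta Hdelta].
  (* Halving keeps [t] positive and strictly below both radii. *)
  set (t := Rmin r delta / 2).
  assert (Hm : 0 < Rmin r delta) by (apply Rmin_pos; apply cond_pos).
  assert (Ht : Rabs t = t) by (apply Rabs_pos_eq; unfold t; lra).
  assert (Htr : Rabs t < r)
    by (rewrite Ht; unfold t; generalize (Rmin_l r delta); lra).
  assert (Htd : Rabs t < delta)
    by (rewrite Ht; unfold t; generalize (Rmin_r r delta); lra).
  specialize (Hdelta (RtoC t)). rewrite Cmod_R in Hdelta.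
  specialize (Hdelta Htd). simpl in Hdelta.
  rewrite <- RtoC_plus in Hdelta.
  pose proof (Rle_trans _ _ _ (Im_le_Cmod _) Hdelta) as HI.
  assert (E : Im (F (RtoC (x + t)) - F (RtoC x) - RtoC t * D)%C = - (t * Im D)).
  { transitivity (Im (F (RtoC (x + t))) - Im (F (RtoC x)) - t * Im D).
    - unfold Im; simpl; ring.
    - rewrite (Hreal _ (Hr t Htr)), (Hreal _ Hx). ring. }
  rewrite E, Rabs_Ropp, Rabs_mult, Ht in HI.
  assert (0 < t) by (unfold t; lra).
  nra.
Qed.

(** Multiplication by [Ci] moves the real part of [D] into the imaginary part:
    [Im (Ci * h * D) = h * Re D]. *)
Lemma is_lim_Im_imaginary_step (F : C -> C) (x : R) (D : C) :
  Im (F (RtoC x)) = 0 ->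
  @is_derive C_AbsRing C_NormedModule F (RtoC x) D ->
  is_lim (fun h : R => Im (F (RtoC x + Ci * RtoC h)%C) / h) 0 (Re D).
Proof.
  intros HFx HD. apply is_lim_spec. intros eps.
  (* Half of [eps], since the expansion gives a non-strict bound and the limit asks for a strict
     one. *)
  destruct (is_C_derive_expansion F x D HD (pos_div_2 eps)) as [delta Hdelta].
  exists delta. intros h Hh Hh0.
  change (Rabs (h - 0) < delta) in Hh. rewrite Rminus_0_r in Hh.
  assert (Hmod : Cmod (Ci * RtoC h)%C = Rabs h).
  { rewrite Cmod_mult, Cmod_R, Cmod_Ci. ring. }
  specialize (Hdelta (Ci * RtoC h)%C). rewrite Hmod in Hdelta.
  specialize (Hdelta Hh). simpl in Hdelta.
  pose proof (Rle_trans _ _ _ (Im_le_Cmod _) Hdelta) as HI.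
  set (v := F (RtoC x + Ci * RtoC h)%C) in *.
  assert (E : Im (v - F (RtoC x) - Ci * RtoC h * D)%C = (Im v / h - Re D) * h).
  { transitivity (Im v - Im (F (RtoC x)) - h * Re D).
    - unfold Im, Re; simpl; ring.
    - rewrite HFx. field. exact Hh0. }
  rewrite E, Rabs_mult in HI.
  pose proof (Rabs_pos_lt h Hh0). pose proof (cond_pos eps).
  apply Rmult_le_reg_r in HI; [lra | assumption].
Qed.

Theorem theorem3p1 (Omega : C -> Prop) (F : C -> C)
  (Omega_open : @open C_UniformSpace Omega)
  (Omega_interval : exists a b : R,
      a < b /\ forall t : R, a < t < b -> Omega (RtoC t))
  (F_holo : holomorphic_on Omega F)
  (F_real : forall x : R, Omega (RtoC x) -> Im (F (RtoC x)) = 0) :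
  forall x : R, Omega (RtoC x) ->
    exists d : R,
      is_real_derive F x (RtoC d) /\
      is_lim (fun h : R => Im (F (RtoC x + Ci * RtoC h)%C) / h) 0 d.
Proof.
  intros x Hx. destruct (F_holo _ Hx) as [D HD].
  pose proof (Im_derive_real_on_reals Omega F x D Omega_open F_real Hx HD) as HIm.
  exists (Re D). split.
  (* The vanishing of [Im D] identifies the real limit [Re D] with the derivative [D] itself. *)
  - replace (RtoC (Re D)) with D.
    + exact (is_C_derive_is_real_derive F x D HD).
    + destruct D as [a b]. unfold RtoC. simpl in *. now rewrite HIm.
  - exact (is_lim_Im_imaginary_step F x D (F_real x Hx) HD).
Qed.
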